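(* Let $0<\varepsilon<2$. Suppose there is a constant $c_\varepsilon>0$ such that $|E+E|\ge c_\varepsilon |E|^{2-\varepsilon}$ for every finite set $E$ of squares. Then there is a constant $C$ such that $\sigma(k)\le C\,k^{\frac12+\frac{\varepsilon}{4-2\varepsilon}}$ for all integers $k\ge 1$. (In particular, if the hypothesis holds for every $\varepsilon>0$, then $\sigma(k)=O_\eta(k^{1/2+\eta})$ for every $\eta>0$.)
   Context: A square is the square of an integer. For a finite set $E$ of integers, $E+E=\{x+y: x,y\in E\}$. For a positive integer $k$, $\sigma(k)$ denotes the maximum, over all positive integers $a$ and $b$, of the number of squares among $a+b,a+2b,\dots,a+kb$. *)

(* Defs.v *)
From HB Require Import structures.
From mathcomp Require Import all_boot all_order all_algebra.
From mathcomp Require Import finmap.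
From mathcomp Require Import boolp reals exp.

Set Implicit Arguments.
Unset Strict Implicit.
Unset Printing Implicit Defensive.

Import Order.TTheory GRing.Theory Num.Theory.

Local Open Scope fset_scope.
Local Open Scope ring_scope.

Definition is_square (x : int) : Prop := exists m : int, x = m ^+ 2.

Definition sumset (E : {fset int}) : {fset int} :=
  [fset x + y | x in E, y in E].

(* [b] is meant to be positive, so the listed terms are pairwise distinct. *)
Definition num_squares (k : nat) (a b : int) : nat :=
  count (fun x => `[< is_square x >]) [seq a + b *+ i | i <- iota 1 k].

(* The maximum over all positive [a], [b] is taken over the set of attained
   values, all of which are at most [k]; see [sigma_attained], [sigma_max]. *)
Definition sigma (k : nat) : nat :=
  (\max_(n < k.+1 | `[< exists a b : int,
      [/\ 0 < a, 0 < b & num_squares k a b = n]%R >]) n)%N.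

Lemma num_squares_le k a b : (num_squares k a b <= k)%N.
Proof.
by rewrite /num_squares (leq_trans (count_size _ _)) // size_map size_iota.
Qed.

Lemma sigma_attained k :
  exists a b : int, [/\ 0 < a, 0 < b & num_squares k a b = sigma k].
Proof.
pose n0 : 'I_k.+1 := inord (num_squares k 1 1).
have P0 : `[< exists a b : int, [/\ 0 < a, 0 < b & num_squares k a b = n0] >].
  by apply/asboolP; exists 1, 1; split; rewrite // inordK // ltnS num_squares_le.
rewrite /sigma (bigop.bigmax_eq_arg n0) //.
by case: arg_maxnP => //= n /asboolP.
Qed.

Lemma sigma_max k (a b : int) :
  0 < a -> 0 < b -> (num_squares k a b <= sigma k)%N.
Proof.
move=> a0 b0; have lek : (num_squares k a b < k.+1)%N by rewrite ltnS num_squares_le.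
apply: (bigop.leq_bigmax_cond (Ordinal lek)).
by apply/asboolP; exists a, b.
Qed.

Definition sumset_lower_bound (R : realType) (eps : R) : Prop :=
  exists2 c : R, 0 < c &
    forall E : {fset int}, (forall x, x \in E -> is_square x) ->
      c * (#|` E|%:R `^ (2 - eps)) <= #|` sumset E|%:R.

(* Main.v *)
(** The squares among [a + b, ..., a + k b] form a set [E] whose sumset lies in
    the progression [2 a + j b], [1 <= j <= 2 k], so [c |E|^(2 - eps) <= 2 k];
    solving for [|E|] gives the exponent [1 / (2 - eps)], which equals
    [1 / 2 + eps / (4 - 2 eps)]. *)
Require Import Defs.
From mathcomp Require Import all_boot all_order all_algebra.
From mathcomp Require Import reals exp.
From mathcomp Require Import finmap boolp zify ring lra.

Set Implicit Arguments.
Unset Strict Implicit.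
Unset Printing Implicit Defensive.

Import Order.TTheory GRing.Theory Num.Theory.

Local Open Scope ring_scope.

Lemma card_sumset_progression (k : nat) (a b : int) (E : {fset int}) :
  (forall x, x \in E -> x \in [seq a + b *+ i | i <- iota 1 k]) ->
  (#|` sumset E| <= 2 * k)%N.
Proof.
(* An index [i + j] of a sum lies between 2 and [2 * k]; starting [s] at 1 gives it length exactly
   [2 * k]. *)
move=> subE; pose s := [seq a *+ 2 + b *+ j | j <- iota 1 (2 * k)].
have -> : (2 * k = size s)%N by rewrite size_map size_iota.
apply: (@leq_trans #|` [fset x in s]%fset|); last by rewrite card_fseq size_undup.
apply/fsubset_leq_card/fsubsetP => _ /imfset2P[x /= xE [y /= yE ->]].
move: xE yE => /subE/mapP[i + ->] /subE/mapP[j + ->].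
rewrite !mem_iota !inE => /andP[i1 ik] /andP[_ jk].
apply/mapP; exists (i + j)%N; last by rewrite mulrnDr mulr2n addrACA.
by rewrite mem_iota mul2n -addnn; apply/andP; split; lia.
Qed.

(** The squares in a progression attaining the maximum serve as [E]. *)
Lemma sigma_squares (k : nat) :
  exists E : {fset int},
    [/\ forall x, x \in E -> is_square x, #|` E| = sigma k
      & (#|` sumset E| <= 2 * k)%N].
Proof.
have [a [b [_ b0 <-]]] := sigma_attained k.
pose s := [seq a + b *+ i | i <- iota 1 k].
exists [fset x in [seq x <- s | `[< is_square x >]]]%fset; split.
- by move=> x; rewrite !inE mem_filter => /andP[/asboolP].
- rewrite card_fseq undup_id ?size_filter // filter_uniq // map_inj_uniq ?iota_uniq //.
  (* As [b] is nonzero, the terms are distinct, so counting squares along the list gives the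
     cardinality of the set. *)
  by move=> i j /addrI/(mulrIn (lt0r_neq0 b0)).
- apply: (@card_sumset_progression k a b) => x.
  by rewrite !inE mem_filter => /andP[].
Qed.

Lemma sigma_le_powR (R : realType) (eps : R) : eps < 2 ->
  sumset_lower_bound eps ->
  exists C : R, forall k : nat, (sigma k)%:R <= C * k%:R `^ (2 - eps)^-1.
Proof.
move=> eps2 [c c0 sum_ge]; exists ((2 / c) `^ (2 - eps)^-1) => k.
have d0 : 0 < 2 - eps by rewrite subr_gt0.
have [E [sqE <- sumE]] := sigma_squares k.
rewrite -powRM ?divr_ge0 ?ler0n ?(ltW c0) //.
(* With both sides written as powers of exponent [(2 - eps)^-1], monotonicity leaves only the bases
   to compare: [|E|^(2 - eps) <= (2 / c) * k]. *)
have -> : #|` E|%:R = (#|` E|%:R `^ (2 - eps)) `^ (2 - eps)^-1 :> R.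
  by rewrite -powRrM mulfV ?gt_eqF // powRr1.
apply: ge0_ler_powR; rewrite ?nnegrE ?powR_ge0 ?invr_ge0 ?(ltW d0) //.
  by rewrite mulr_ge0 // divr_ge0 // ltW.
rewrite mulrAC ler_pdivlMr // mulrC (le_trans (sum_ge E sqE)) //.
by rewrite -natrM ler_nat.
Qed.

Theorem theorem4 (R : realType) :
  (forall eps : R, 0 < eps -> eps < 2 ->
     sumset_lower_bound eps ->
     exists C : R, forall k : nat, (1 <= k)%N ->
       (sigma k)%:R <= C * k%:R `^ (1 / 2 + eps / (4 - 2 * eps)))
  /\
  ((forall eps : R, 0 < eps -> eps < 2 -> sumset_lower_bound eps) ->
     forall eta : R, 0 < eta ->
     exists C : R, forall k : nat, (1 <= k)%N ->
       (sigma k)%:R <= C * k%:R `^ (1 / 2 + eta)).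
Proof.
split=> [eps _ eps2 /(sigma_le_powR eps2)[C sigC]|sum_ge eta eta0].
  (* Over the common denominator [2 * (2 - eps)], the numerators add up to [(2 - eps) + eps = 2]. *)
  exists C => k _; have -> // : 1 / 2 + eps / (4 - 2 * eps) = (2 - eps)^-1.
  by field; apply/andP; split; apply/eqP; lra.
(* [eps] solves [eps / (4 - 2 * eps) = eta]. *)
pose eps := 4 * eta / (1 + 2 * eta).
have eps0 : 0 < eps by rewrite divr_gt0 //; lra.
(* This amounts to [4 * eta < 2 + 4 * eta]. *)
have eps2 : eps < 2 by rewrite ltr_pdivrMr; lra.
have [C sigC] := sigma_le_powR eps2 (sum_ge _ eps0 eps2).
exists C => k _; have -> // : 1 / 2 + eta = (2 - eps)^-1.
have -> : 2 - eps = 2 / (1 + 2 * eta) by rewrite /eps; field; apply/eqP; lra.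
by field; apply/eqP; lra.
Qed.
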